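(* (a) The longest square-free tournament words over $A_4=\{0,1,2,3\}$ have length $20$; they are exactly $w=01201320120320132032$ and the words obtained from $w$ by permuting the letters. (b) There exist infinite square-free tournament words over $A_5=\{0,1,2,3,4\}$.
   Context: A (finite or infinite) word $w$ over $A_n$ is a tournament word if for all distinct letters $i,j$, if $ij$ is a factor of $w$ then $ji$ is not a factor of $w$. A word is square-free if it has no factor $uu$ with $u$ nonempty. *)

(* Defs.v *)
From mathcomp Require Import all_boot all_fingroup.

Set Implicit Arguments.
Unset Strict Implicit.
Unset Printing Implicit Defensive.

(* The alphabet A_n = {0, ..., n-1} is 'I_n; a finite word is a seq 'I_n and an
   infinite word is a one-sided infinite sequence nat -> 'I_n. *)

(* The two properties below depend on a finite or infinite word only through
   its set F of finite factors. *)
Definition tournament_factors (n : nat) (F : seq 'I_n -> Prop) : Prop :=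
  forall i j : 'I_n, i <> j -> F [:: i; j] -> ~ F [:: j; i].

Definition square_free_factors (n : nat) (F : seq 'I_n -> Prop) : Prop :=
  forall u : seq 'I_n, u <> [::] -> ~ F (u ++ u).

Definition factor (n : nat) (w u : seq 'I_n) : Prop := infix u w.

Definition inf_factor (n : nat) (x : nat -> 'I_n) (u : seq 'I_n) : Prop :=
  exists k : nat, u = mkseq (fun i => x (k + i)) (size u).

Definition tournament (n : nat) (w : seq 'I_n) : Prop :=
  tournament_factors (factor w).
Definition square_free (n : nat) (w : seq 'I_n) : Prop :=
  square_free_factors (factor w).

Definition inf_tournament (n : nat) (x : nat -> 'I_n) : Prop :=
  tournament_factors (inf_factor x).
Definition inf_square_free (n : nat) (x : nat -> 'I_n) : Prop :=
  square_free_factors (inf_factor x).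

Definition longest (n : nat) (P : seq 'I_n -> Prop) (w : seq 'I_n) : Prop :=
  P w /\ forall v : seq 'I_n, P v -> size v <= size w.

Definition square_free_tournament (n : nat) (w : seq 'I_n) : Prop :=
  square_free w /\ tournament w.

Definition a0 : 'I_4 := @Ordinal 4 0 isT.
Definition a1 : 'I_4 := @Ordinal 4 1 isT.
Definition a2 : 'I_4 := @Ordinal 4 2 isT.
Definition a3 : 'I_4 := @Ordinal 4 3 isT.

Definition w20 : seq 'I_4 :=
  [:: a0; a1; a2; a0; a1; a3; a2; a0; a1; a2;
      a0; a3; a2; a0; a1; a3; a2; a0; a3; a2].

(* Main.v *)
Require Import Defs.
From mathcomp Require Import all_boot all_fingroup.
From mathcomp Require Import zify.

Set Implicit Arguments.
Unset Strict Implicit.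
Unset Printing Implicit Defensive.

(** Part (a) is a finite search: square-free tournament words are closed under
    taking suffixes, so those of length n+1 arise from those of length n by
    prepending a letter, and the process dies out at length 21.

    For part (b), let c = 0134130 and let x(n) be the sum modulo 5 of the c_d
    over the base-7 digits d of n.  Since c_0 = c_6 = 0 and consecutive entries
    of c differ by 1 or 2 modulo 5, so do consecutive terms of x, which makes x
    a tournament word (two such steps never cancel modulo 5).  The word x is
    the fixed point of the morphism a |-> (a + c_0) ... (a + c_6).  A block of
    this morphism can occur in x only at a multiple of 7, and one letter of a
    block together with its place determines the block.  Hence a square of
    period q >= 13, which contains a full block in its first half, has 7 | q
    and yields a square of period q / 7; periods up to 12 are excluded by a
    finite check. *)

(** * Square-free tournament words over four letters *)

Section GoodWords.
Variable T : eqType.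
Implicit Types (w u : seq T) (a : T).

Definition no_square_prefix w : bool :=
  ~~ has (fun q => take q w == take q (drop q w)) (iota 1 (size w)./2).

(** Prepending [a] creates only prefixes as new factors, and [a] followed by [head a w] is the only
    new one of length two. For empty [w] the default of [head] makes the second test succeed. *)
Definition extends_left a w : bool :=
  no_square_prefix (a :: w) &&
  ((a == head a w) || ~~ infix [:: head a w; a] w).

Fixpoint good w : bool :=
  if w is a :: w' then good w' && extends_left a w' else true.

Fixpoint good_words (A : seq T) (n : nat) : seq (seq T) :=
  if n is n'.+1 then
    [seq a :: w | w <- good_words A n', a <- [seq a <- A | extends_left a w]]
  else [:: [::]].

Lemma mem_good_words A w :
  {subset w <= A} -> good w -> w \in good_words A (size w).
Proof.
elim: w => [|a w IHw] //= sA /andP[gw ew].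
apply/allpairsPdep; exists w, a; split=> //.
  by apply: IHw => // b bw; apply: sA; rewrite inE bw orbT.
by rewrite mem_filter ew sA // mem_head.
Qed.

Lemma good_drop k w : good w -> good (drop k w).
Proof. by elim: w k => [|a w IHw] [|k] //= /andP[gw _]; apply: IHw. Qed.

Lemma no_square_prefixP w :
  reflect (forall u, u <> [::] -> ~~ prefix (u ++ u) w) (no_square_prefix w).
Proof.
apply: (iffP idP) => [/hasPn nsq u u0 | nsq].
  apply/negP => /prefixP[v wE].
  have u_gt0 : 0 < size u by case: (u) u0.
  have := nsq (size u); rewrite mem_iota wE !size_cat.
  rewrite -catA take_size_cat // drop_size_cat // take_size_cat // eqxx.
  by move/(_ _)/negP; case=> //; lia.
apply/hasPn => q; rewrite mem_iota => qw.
have q_le : q + q <= size w by lia.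
apply/negP => /eqP sq.
have sz : size (take q w) = q by rewrite size_takel //; lia.
have u0 : take q w <> [::] by move=> e; move: sz; rewrite e /=; lia.
move/negP: (nsq _ u0); apply.
apply/prefixP; exists (drop (q + q) w).
by rewrite {2}sq -catA -drop_drop cat_take_drop cat_take_drop.
Qed.

End GoodWords.

Section FactorWords.
Variable n : nat.
Implicit Types (w : seq 'I_n) (a : 'I_n).

Lemma square_free_tournament_cons a w :
  square_free_tournament (a :: w) <->
  square_free_tournament w /\ extends_left a w.
Proof.
rewrite /square_free_tournament /square_free /square_free_factors.
rewrite /tournament /tournament_factors /factor /extends_left.
split=> [[sqf tou] | [[sqf tou] /andP[/no_square_prefixP nsq ok]]].
  split; [split |].
  - by move=> u u0 uw; apply: (sqf u u0); rewrite infix_consl uw orbT.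
  - by move=> i j ij ijw jiw; apply: (tou i j ij);
      rewrite infix_consl ?ijw ?jiw orbT.
  apply/andP; split.
    apply/no_square_prefixP => u u0; apply/negP => uw.
    by apply: (sqf u u0); rewrite infix_consl uw.
  case: w sqf tou => [|b w] sqf tou /=; first by rewrite eqxx.
  case: eqVneq => //= ab; apply/negP => ba.
  apply: (tou a b); first exact/eqP.
    by rewrite infix_consl !prefix_cons !eqxx prefix0s.
  by rewrite infix_consl; apply/orP; right.
split=> [u u0 | i j ij].
  by rewrite infix_consl => /orP[|/(sqf u u0)//]; apply/negP/nsq.
(* A pair of distinct letters at the front is [a] followed by the head of [w], whose reversal [ok]
   forbids. *)
have base k l : k <> l -> prefix [:: k; l] (a :: w) ->
    ~ infix [:: l; k] (a :: w).
  move=> kl; case: w ok {sqf tou nsq} => [|b w] /=; first by rewrite andbF.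
  move=> ok /and3P[/eqP ka /eqP lb _]; subst k l.
  by case: eqVneq ok => [/kl//|_] /= /negP.
move=> ijw jiw; move: (ijw) (jiw); rewrite !infix_consl.
case/orP=> [p _|ijw']; first exact: base p jiw.
case/orP=> [p|]; last exact: tou.
by apply: base p ijw => /esym.
Qed.

Lemma goodP w : reflect (square_free_tournament w) (good w).
Proof.
apply: (iffP idP); elim: w => [|a w IHw] //=.
- move=> _; split=> [u u0|i j ij]; rewrite /factor infixs0 //.
  by case: u u0.
- by case/andP=> /IHw sw ew; apply/square_free_tournament_cons.
by case/square_free_tournament_cons=> /IHw -> ->.
Qed.

Lemma square_free_tournament_map (s : {perm 'I_n}) w :
  square_free_tournament w -> square_free_tournament (map s w).
Proof.
have pull u : factor (map s w) u -> factor w (map (s^-1)%g u).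
  case/infixP=> p [q e]; apply/infixP; exists (map (s^-1)%g p), (map (s^-1)%g q).
  rewrite -!map_cat -e -map_comp map_id_in // => i _ /=; exact: permK.
case=> sqf tou; split=> [u u0 /pull | i j ij /pull ijw /pull jiw].
  by rewrite map_cat; apply: sqf; case: u u0.
by apply: tou ijw jiw => /perm_inj.
Qed.

End FactorWords.

(** * Exhaustive search over four letters *)

Definition letters4 : seq 'I_4 := [:: a0; a1; a2; a3].

Lemma mem_letters4 (i : 'I_4) : i \in letters4.
Proof. by case: i => [[|[|[|[|i]]]] Hi]. Qed.

(* The letters 0, 1, 2, 3 first occur in w20 at positions 0, 1, 2, 5. *)
Definition relabelling (w : seq 'I_4) (i : 'I_4) : 'I_4 :=
  nth a0 w (nth 0 [:: 0; 1; 2; 5] i).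

(** The [uniq] test makes each relabelling injective, hence a permutation of the four letters. *)
Lemma good_words4_20 :
  all (fun w => uniq (map (relabelling w) letters4) &&
                (w == map (relabelling w) w20))
      (good_words letters4 20).
Proof. by vm_compute. Qed.

Lemma good_words4_21 : good_words letters4 21 = [::].
Proof. by vm_compute. Qed.

Lemma good_w20 : good w20.
Proof. by vm_compute. Qed.

Lemma size_square_free_tournament4 (w : seq 'I_4) :
  square_free_tournament w -> size w <= 20.
Proof.
move=> /goodP gw; rewrite leqNgt; apply/negP => lt20.
(* The suffix of length 21 would belong to an empty list. *)
have := mem_good_words (fun i _ => mem_letters4 i) (good_drop (size w - 21) gw).
by rewrite size_drop subKn // good_words4_21.
Qed.

Lemma square_free_tournament4_20 (w : seq 'I_4) :
  square_free_tournament w -> size w = 20 ->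
  exists s : {perm 'I_4}, w = map s w20.
Proof.
move=> /goodP gw sz.
have := mem_good_words (fun i _ => mem_letters4 i) gw; rewrite sz.
move/(allP good_words4_20)=> /andP[uf /eqP wE].
have inj_f : injective (relabelling w).
  move=> i j eij; apply/eqP.
  have si : index i letters4 < size letters4 by rewrite index_mem mem_letters4.
  have sj : index j letters4 < size letters4 by rewrite index_mem mem_letters4.
  rewrite -(nth_index a0 (mem_letters4 i)) -(nth_index a0 (mem_letters4 j)).
  rewrite nth_uniq // -(@nth_uniq _ a0 (map (relabelling w) letters4)) ?size_map //.
  by rewrite !(nth_map a0) // !nth_index ?mem_letters4 // eij.
by exists (perm inj_f); rewrite [LHS]wE; apply: eq_map => i; rewrite permE.
Qed.

(** * A square-free tournament word over five letters *)

Definition digit_weight (d : nat) : nat := nth 0 [:: 0; 1; 3; 4; 1; 3; 0] d.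

Fixpoint digit_sum_fuel (f n : nat) : nat :=
  if f is f'.+1 then (digit_sum_fuel f' (n %/ 7) + digit_weight (n %% 7)) %% 5
  else 0.

Definition digit_sum (n : nat) : nat := digit_sum_fuel n n.

(** Surplus fuel only reads leading zeros, and the digit 0 has weight 0. *)
Lemma digit_sum_fuelE f n : n <= f -> digit_sum_fuel f n = digit_sum n.
Proof.
rewrite /digit_sum.
elim/ltn_ind: f n => -[|f] IHf [|n] //= le_nf.
  by rewrite div0n IHf.
have lt_f : n.+1 %/ 7 <= f by lia.
have lt_n : n.+1 %/ 7 <= n by lia.
rewrite (IHf f) // -(IHf n) //; lia.
Qed.

Lemma digit_sum_block k r :
  r < 7 -> digit_sum (7 * k + r) = (digit_sum k + digit_weight r) %% 5.
Proof.
move=> r7; case E: (7 * k + r) => [|n].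
  have [-> ->] : k = 0 /\ r = 0 by lia.
  by [].
rewrite {1}/digit_sum /= digit_sum_fuelE; last lia.
by have [-> ->] : n.+1 %/ 7 = k /\ n.+1 %% 7 = r by lia.
Qed.

Lemma digit_sum_lt5 n : digit_sum n < 5.
Proof. by case: n => [|n] //; rewrite ltn_mod. Qed.

(** If the last digit is below 6, the step is a difference of consecutive weights. Otherwise the
    carry turns a last digit 6 into 0, both of weight 0, and the step is that of [n %/ 7]. *)
Lemma digit_sum_step n :
  exists2 d, d \in [:: 1; 2] & digit_sum n.+1 = (digit_sum n + d) %% 5.
Proof.
elim/ltn_ind: n => n IHn.
have [r6|r6] := ltnP (n %% 7) 6.
  have sumn : digit_sum n = (digit_sum (n %/ 7) + digit_weight (n %% 7)) %% 5.
    by rewrite -digit_sum_block; [congr digit_sum|]; lia.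
  have sumn1 :
      digit_sum n.+1 = (digit_sum (n %/ 7) + digit_weight (n %% 7).+1) %% 5.
    by rewrite -digit_sum_block; [congr digit_sum|]; lia.
  rewrite sumn sumn1; move: (n %% 7) r6 (digit_sum _) {sumn sumn1} => r r6 b.
  (* These are the places [r] where the weight grows by 2 modulo 5. *)
  exists (if r \in [:: 1; 3; 4; 5] then 2 else 1).
    by case: ifP.
  rewrite modnDml -addnA -[LHS]modnDmr -[RHS]modnDmr.
  by case: r r6 => [|[|[|[|[|[|r]]]]]].
have sumn : digit_sum n = digit_sum (n %/ 7).
  rewrite -[RHS](modn_small (digit_sum_lt5 _)) -[X in X %% 5](addn0 (digit_sum _)).
  by rewrite -(@digit_sum_block _ 6) //; congr digit_sum; lia.
have sumn1 : digit_sum n.+1 = digit_sum (n %/ 7).+1.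
  rewrite -[RHS](modn_small (digit_sum_lt5 _)) -[X in X %% 5](addn0 (digit_sum _)).
  by rewrite -(@digit_sum_block _ 0) //; congr digit_sum; lia.
by rewrite sumn sumn1; apply: IHn; lia.
Qed.

(* [window b ds] is the image under the morphism of the word that starts with
   the letter [b] and has successive differences [ds]. *)
Fixpoint window (b : nat) (ds : seq nat) : seq nat :=
  [seq (b + digit_weight r) %% 5 | r <- iota 0 7] ++
  (if ds is d :: ds' then window ((b + d) %% 5) ds' else [::]).

Fixpoint step_seqs (n : nat) : seq (seq nat) :=
  if n is n'.+1 then [seq d :: ds | d <- [:: 1; 2], ds <- step_seqs n']
  else [:: [::]].

Lemma digit_sum_window_head j ds i : i < 7 ->
  digit_sum (7 * j + i) = nth 0 (window (digit_sum j) ds) i.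
Proof.
move=> i7; rewrite digit_sum_block //.
by case: ds i i7 => [|d ds] [|[|[|[|[|[|[|i]]]]]]].
Qed.

(** Reduces statements about [n.+1] consecutive blocks to finitely many cases: a first letter and
    [n] steps from {1, 2}. *)
Lemma digit_sum_window n j :
  exists2 ds, ds \in step_seqs n &
    forall i, i < 7 * n.+1 ->
      digit_sum (7 * j + i) = nth 0 (window (digit_sum j) ds) i.
Proof.
elim: n j => [|n IHn] j.
  by exists [::] => // i i7; apply: digit_sum_window_head; lia.
have [d dP dE] := digit_sum_step j.
have [ds dsP dsE] := IHn j.+1.
exists (d :: ds); first exact: allpairs_f.
move=> i lt_i; have [i7|i7] := ltnP i 7; first exact: digit_sum_window_head.
have -> : 7 * j + i = 7 * j.+1 + (i - 7) by lia.
rewrite dsE; last lia.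
rewrite [window _ (d :: ds)]/= -dE.
by case: i i7 {lt_i} => [|[|[|[|[|[|[|i]]]]]]] //= _; rewrite !subSS subn0.
Qed.

(** Seven letters starting at an offset from 1 to 6 in a block end in the next one, so two blocks
    suffice. *)
Lemma block_sync_check :
  all (fun b => all (fun ds => all (fun a => all (fun s =>
    [seq (a + digit_weight r) %% 5 | r <- iota 0 7]
      != [seq nth 0 (window b ds) (s + r) | r <- iota 0 7])
    (iota 1 6)) (iota 0 5)) (step_seqs 1)) (iota 0 5).
Proof. by vm_compute. Qed.

Lemma block_sync k m :
  (forall i, i < 7 -> digit_sum (7 * k + i) = digit_sum (m + i)) -> 7 %| m.
Proof.
move=> eqb; have [ds dsP dsE] := digit_sum_window 1 (m %/ 7).
apply: contraT => ndvd.
have bP : digit_sum (m %/ 7) \in iota 0 5 by rewrite mem_iota digit_sum_lt5.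
have aP : digit_sum k \in iota 0 5 by rewrite mem_iota digit_sum_lt5.
have sP : m %% 7 \in iota 1 6 by rewrite mem_iota; lia.
have /allP/(_ _ dsP)/allP/(_ _ aP)/allP/(_ _ sP)/negP[] := allP block_sync_check _ bP.
apply/eqP/eq_in_map => r; rewrite mem_iota => r7.
rewrite -digit_sum_block // eqb // -dsE; last lia.
congr digit_sum; lia.
Qed.

(** The largest position read is 6 + 12 + 11 = 29, within the 35 letters of five blocks. *)
Lemma short_square_check :
  all (fun b => all (fun ds => all (fun r => all (fun q =>
    ~~ all (fun i => nth 0 (window b ds) (r + i)
                       == nth 0 (window b ds) (r + q + i)) (iota 0 q))
    (iota 1 12)) (iota 0 7)) (step_seqs 4)) (iota 0 5).
Proof. by vm_compute. Qed.

Lemma digit_sum_no_short_square p q : 0 < q <= 12 ->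
  ~ (forall i, i < q -> digit_sum (p + i) = digit_sum (p + q + i)).
Proof.
move=> q12 sq; have [ds dsP dsE] := digit_sum_window 4 (p %/ 7).
have bP : digit_sum (p %/ 7) \in iota 0 5 by rewrite mem_iota digit_sum_lt5.
have rP : p %% 7 \in iota 0 7 by rewrite mem_iota; lia.
have qP : q \in iota 1 12 by rewrite mem_iota; lia.
have /allP/(_ _ dsP)/allP/(_ _ rP)/allP/(_ _ qP)/negP[] := allP short_square_check _ bP.
apply/allP => i; rewrite mem_iota => iq.
rewrite -!dsE; try lia.
have -> : 7 * (p %/ 7) + (p %% 7 + i) = p + i by lia.
have -> : 7 * (p %/ 7) + (p %% 7 + q + i) = p + q + i by lia.
by rewrite sq //; lia.
Qed.

Lemma digit_sum_block_inj k l r : r < 7 ->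
  digit_sum (7 * k + r) = digit_sum (7 * l + r) -> digit_sum k = digit_sum l.
Proof.
move=> r7; rewrite !digit_sum_block // => /eqP; rewrite eqn_modDr => /eqP.
by rewrite !modn_small ?digit_sum_lt5.
Qed.

Lemma digit_sum_square_free p q : 0 < q ->
  ~ (forall i, i < q -> digit_sum (p + i) = digit_sum (p + q + i)).
Proof.
elim/ltn_ind: q p => q IHq p q0 sq.
have [q12|q12] := leqP q 12.
  by apply: (@digit_sum_no_short_square p q); rewrite ?q0.
have q7 : 7 %| q.
  (* Block [k] is the first to start at or after [p]. It ends before [p + q] because [q >= 13], so
     it recurs [q] places later. *)
  pose k := (p + 6) %/ 7.
  have : 7 %| 7 * k + q.
    apply: (@block_sync k) => i i7.
    have -> : 7 * k + i = p + (7 * k + i - p) by lia.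
    have -> : 7 * k + q + i = p + q + (7 * k + i - p) by lia.
    apply: sq; lia.
  lia.
(* Reading every seventh letter from [p] on meets each block at the same place [p %% 7], which
   determines the letter it comes from. *)
apply: (IHq (q %/ 7) _ (p %/ 7)); try lia.
move=> i iq; apply: (@digit_sum_block_inj _ _ (p %% 7)); first lia.
have -> : 7 * (p %/ 7 + i) + p %% 7 = p + 7 * i by lia.
have -> : 7 * (p %/ 7 + q %/ 7 + i) + p %% 7 = p + q + 7 * i by lia.
apply: sq; lia.
Qed.

(** * The infinite word over five letters *)

Definition digit_sum_word (n : nat) : 'I_5 := Ordinal (digit_sum_lt5 n).

Lemma digit_sum_word_square_free : inf_square_free digit_sum_word.
Proof.
move=> u u0 [k uuE]; have u_gt0 : 0 < size u by case: (u) u0.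
apply: (@digit_sum_square_free k (size u)) => // i iu.
have at_ j : j < size u + size u ->
    digit_sum (k + j) = nth ord0 (u ++ u) j.
  by move=> ju; rewrite uuE nth_mkseq ?size_cat.
rewrite -addnA !at_; try lia.
by rewrite !nth_cat iu ltnNge leq_addr /= addKn.
Qed.

Lemma digit_sum_word_tournament : inf_tournament digit_sum_word.
Proof.
move=> i j _ [k [iE jE]] [l [jE' iE']].
have [d dP dE] := digit_sum_step k; have [e eP eE] := digit_sum_step l.
have ik : digit_sum k = i by rewrite iE /= addn0.
have jk : digit_sum k.+1 = j by rewrite jE /= addn1.
have jl : digit_sum l = j by rewrite jE' /= addn0.
have il : digit_sum l.+1 = i by rewrite iE' /= addn1.
have := ltn_ord i; have := ltn_ord j.
rewrite ik jk in dE; rewrite jl il in eE.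
(* Going from [i] to [j] and back would make [d + e], which lies between 2 and 4, a multiple of
   5. *)
move: dP eP; rewrite !inE; lia.
Qed.

Theorem theorem12 :
  ((forall w : seq 'I_4, longest (@square_free_tournament 4) w -> size w = 20)
   /\ (forall w : seq 'I_4,
         longest (@square_free_tournament 4) w
         <-> exists s : {perm 'I_4}, w = map s w20))
  /\ (exists x : nat -> 'I_5, inf_square_free x /\ inf_tournament x).
Proof.
have sft_w20 : square_free_tournament w20 by apply/goodP/good_w20.
have size_longest w : longest (@square_free_tournament 4) w -> size w = 20.
  case=> sw max_w; apply/eqP; rewrite eqn_leq size_square_free_tournament4 //.
  exact: max_w sft_w20.
split; last first.
  exists digit_sum_word; split; first exact: digit_sum_word_square_free.
  exact: digit_sum_word_tournament.
split=> // w; split=> [lw | [s ->]].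
  by apply: square_free_tournament4_20 (size_longest w lw); case: lw.
split; first exact: square_free_tournament_map.
by move=> v sv; rewrite size_map; apply: size_square_free_tournament4.
Qed.
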